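(* Let $A=(A,d=\Delta_0,\Delta_1,\Delta_2,\dots)$ be a multicomplex over a field $\mathbb K$ of characteristic $0$. Then, in the category of multicomplexes with $\infty$-morphisms, $A$ is $\infty$-isomorphic to the product of a minimal multicomplex $H=H(A)$, namely the homology $H(A,d)$ with the transferred structure $(H(A),0,\Delta'_1,\Delta'_2,\dots)$, with an acyclic trivial multicomplex $K$.
   Context: Multicomplex: a graded vector space $A$ with linear operators $\Delta_n$, $n\ge0$, of degree $2n-1$, satisfying $\sum_{i=0}^n\Delta_i\Delta_{n-i}=0$ for all $n\ge0$; write $d=\Delta_0$. It is minimal if $d=0$, acyclic if $(A,d)$ is an acyclic chain complex, and trivial if $\Delta_n=0$ for all $n\ge1$. $\infty$-morphism $f:A\rightsquigarrow A'$: a family of linear maps $f_n:A\to A'$, $n\ge0$, of degree $2n$, with $\sum_{k+l=n}f_k\Delta_l=\sum_{k+l=n}\Delta'_kf_l$ for all $n\ge0$. Composition is $(gf)_n=\sum_{k+l=n}g_kf_l$. An $\infty$-isomorphism is an $\infty$-morphism with $f_0$ an isomorphism; these are exactly the invertible morphisms of the category. In this category, the product of two multicomplexes is the direct sum with the operators acting componentwise. Transferred structure: take a homotopy retract of $(A,d)$ onto $(H(A),0)$, where $H(A)=H(A,d)$; that is, a chain map $p:A\to H(A)$, a quasi-isomorphism $i:H(A)\to A$ and a linear map $h:A\to A$ of degree $1$ with $ip-\mathrm{id}_A=dh+hd$. The transferred operators are $$\Delta'_n:=\sum_{i_1+\cdots+i_k=n}p\,\Delta_{i_1}h\,\Delta_{i_2}h\cdots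 h\,\Delta_{i_k}\,i,\qquad n\ge1,$$ the sum being over all $k\ge1$ and $i_1,\dots,i_k\ge1$ with the given sum. They make $(H(A),0,\Delta'_1,\Delta'_2,\dots)$ a multicomplex (Homotopy Transfer Theorem). *)

(* Defs.v *)
From HB Require Import structures.
From mathcomp Require Import all_boot all_order all_algebra.
From mathcomp Require Import generic_quotient ring_quotient.
From mathcomp Require Import boolp.

Set Implicit Arguments.
Unset Strict Implicit.
Unset Printing Implicit Defensive.

Import GRing.Theory.
Local Open Scope ring_scope.
Local Open Scope quotient_scope.

(* The library provides quotients of zmodTypes only; the scalar action        *)
(* descends to the quotient by a submodule.                                   *)
Section LmodQuotient.
Variables (R : pzRingType) (V : lmodType R).
Variables (S : {pred V}) (submodS : submod_closed S).

Definition submod_pred & submod_closed S : {pred V} := S.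
HB.instance Definition _ :=
  GRing.isSubmodClosed.Build R V (submod_pred submodS) submodS.

Definition lmod_quot : Type := Quotient.quot (submod_pred submodS).
HB.instance Definition _ := GRing.Zmodule.on lmod_quot.

Definition quot_class (x : V) : lmod_quot :=
  \pi_(Quotient.quot (submod_pred submodS)) x.
Definition quot_repr (c : lmod_quot) : V :=
  repr (c : Quotient.quot (submod_pred submodS)).

Lemma quot_reprK : cancel quot_repr quot_class.
Proof. by move=> c; rewrite /quot_class /quot_repr reprK. Qed.

Lemma quot_classP x y : (quot_class x = quot_class y) <-> (x - y \in S).
Proof.
rewrite -[_ \in S]/(_ \in submod_pred submodS).
rewrite Quotient.idealrBE; split=> [h|/eqP h]; [apply/eqP; exact: h|exact: h].
Qed.

Lemma quot_classD : {morph quot_class : x y / x + y}.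
Proof. by move=> x y; rewrite /quot_class raddfD. Qed.

Definition quot_scale (a : R) (c : lmod_quot) : lmod_quot :=
  quot_class (a *: quot_repr c).

Lemma quot_classZ a x : quot_class (a *: x) = quot_scale a (quot_class x).
Proof.
apply/quot_classP; rewrite -scalerBr.
rewrite -[_ \in S]/(_ \in submod_pred submodS); apply: rpredZ.
by apply/quot_classP; rewrite quot_reprK.
Qed.

Lemma quot_scaleA a b v : quot_scale a (quot_scale b v) = quot_scale (a * b) v.
Proof. by rewrite -[v]quot_reprK -!quot_classZ scalerA. Qed.

Lemma quot_scale1 : left_id 1 quot_scale.
Proof. by move=> v; rewrite -[v]quot_reprK -!quot_classZ scale1r. Qed.

Lemma quot_scaleDr : right_distributive quot_scale +%R.
Proof.
move=> a u v; rewrite -[u]quot_reprK -[v]quot_reprK.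
by rewrite -quot_classD -!quot_classZ scalerDr quot_classD.
Qed.

Lemma quot_scaleDl v : {morph quot_scale^~ v : a b / a + b}.
Proof.
by move=> a b; rewrite -[v]quot_reprK -!quot_classZ scalerDl quot_classD.
Qed.

HB.instance Definition _ := GRing.Zmodule_isLmodule.Build R lmod_quot
  quot_scaleA quot_scale1 quot_scaleDr quot_scaleDl.

End LmodQuotient.

(* The subquotient ker g / (im f :&: ker g) of V, for f : U -> V and          *)
(* g : V -> W; this is ker g / im f as soon as g \o f = 0.                    *)
Section Subquotient.
Variables (R : pzRingType) (U V W : lmodType R).
Variables (f : {linear U -> V}) (g : {linear V -> W}).

Definition ker_pred : {pred V} := fun x => g x == 0.

Lemma ker_pred_submod : submod_closed ker_pred.
Proof.
split=> [|a x y]; rewrite !unfold_in ?linear0 // => /eqP gx /eqP gy.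
by rewrite linearP gx gy scaler0 addr0.
Qed.
HB.instance Definition _ := GRing.isSubmodClosed.Build R V ker_pred
  ker_pred_submod.

Record ker_type : Type :=
  KerType { ker_val : V; ker_valP : ker_val \in ker_pred }.
HB.instance Definition _ := [isSub for ker_val].
HB.instance Definition _ := [Choice of ker_type by <:].
HB.instance Definition _ := [SubChoice_isSubLmodule of ker_type by <:].

Definition im_pred : {pred ker_type} := fun z => `[< exists u, f u = val z >].

Lemma im_pred_submod : submod_closed im_pred.
Proof.
split=> [|a x y]; rewrite !unfold_in.
  by apply/asboolP; exists 0; rewrite !linear0.
move=> /asboolP[u fu] /asboolP[v fv]; apply/asboolP; exists (a *: u + v).
by rewrite !linearP fu fv.
Qed.
Definition subquot : lmodType R := lmod_quot im_pred_submod.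

End Subquotient.

Section Graded.
Variable K : fieldType.

Definition graded := int -> lmodType K.
Identity Coercion graded_fun : graded >-> Funclass.

(* A homogeneous linear map of degree d is encoded by all its components      *)
(* A_i -> B_j, those with j != i + d being zero.  No transport along          *)
(* equalities between degrees is then ever needed.                            *)
Record ghom (d : int) (A B : graded) := GHom {
  ghom_fun :> forall i j, {linear A i -> B j};
  ghom_deg : forall i j, j != i + d -> forall x, ghom_fun i j x = 0
}.

Definition gcast (d e : int) (A B : graded) (de : d = e) (f : ghom d A B) :
  ghom e A B.
Proof.
by exists (ghom_fun f) => i j ne x; apply: ghom_deg; rewrite de.
Defined.

Definition gzero (d : int) (A B : graded) : ghom d A B.
Proof. by exists (fun i j => \0 : {linear A i -> B j}). Defined.

Definition gcomp (d e : int) (A B C : graded) (g : ghom e B C)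
  (f : ghom d A B) : ghom (d + e) A C.
Proof.
exists (fun i k => (g (i + d) k \o f i (i + d)) : {linear A i -> C k}).
by move=> i k ne x /=; apply: ghom_deg; rewrite -addrA.
Defined.

Lemma gcompE (d e : int) (A B C : graded) (g : ghom e B C) (f : ghom d A B)
  i j k x : j = i + d -> gcomp g f i k x = g j k (f i j x).
Proof. by move=> ->. Qed.

Record chain_complex := ChainComplex {
  cc_carrier :> graded;
  cc_diff : ghom (-1) cc_carrier cc_carrier;
  cc_diff2 : forall i j x, gcomp cc_diff cc_diff i j x = 0
}.

Definition homology (C : chain_complex) : graded := fun k =>
  subquot (cc_diff C (k + 1) k) (cc_diff C k (k - 1)).

Record chain_map (C D : chain_complex) := ChainMap {
  cm_hom :> ghom 0 C D;
  cm_comm : forall i j x,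
    gcomp (cc_diff D) cm_hom i j x = gcomp cm_hom (cc_diff C) i j x
}.

Lemma chain_map_comm (C D : chain_complex) (f : chain_map C D) i x :
  cc_diff D i (i - 1) (f i i x) = f (i - 1) (i - 1) (cc_diff C i (i - 1) x).
Proof.
rewrite -(gcompE (cc_diff D)) ?addr0 //.
by rewrite cm_comm; apply: gcompE.
Qed.

Section HomologyMap.
Variables (C D : chain_complex) (f : chain_map C D) (k : int).

Lemma cycle_map_subproof (z : ker_type (cc_diff C k (k - 1))) :
  f k k (val z) \in ker_pred (cc_diff D k (k - 1)).
Proof.
have := ker_valP z; rewrite !unfold_in => /eqP dz.
by rewrite chain_map_comm dz linear0.
Qed.

Definition cycle_map (z : ker_type (cc_diff C k (k - 1))) :
  ker_type (cc_diff D k (k - 1)) := KerType (cycle_map_subproof z).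

Definition homology_map (c : homology C k) : homology D k :=
  quot_class _ (cycle_map (quot_repr c)).

Lemma homology_mapE z :
  homology_map (quot_class _ z) = quot_class _ (cycle_map z).
Proof.
apply/quot_classP; rewrite unfold_in; apply/asboolP.
set y := quot_repr _.
have /quot_classP : quot_class (im_pred_submod (cc_diff C (k + 1) k)
  (cc_diff C k (k - 1))) y = quot_class _ z by rewrite quot_reprK.
rewrite unfold_in => /asboolP[u /= du]; exists (f (k + 1) (k + 1) u).
have := chain_map_comm f u; rewrite addrK => ->.
by rewrite du linearB.
Qed.

End HomologyMap.

Definition quasi_iso (C D : chain_complex) (f : chain_map C D) : Prop :=
  forall k, bijective (@homology_map C D f k).

Lemma zero_diff_subproof (A : graded) i j x :
  gcomp (gzero (-1) A A) (gzero (-1) A A) i j x = 0.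
Proof. by []. Qed.

Definition zero_diff_complex (A : graded) : chain_complex :=
  ChainComplex (@zero_diff_subproof A).

Definition homology_complex (C : chain_complex) : chain_complex :=
  zero_diff_complex (homology C).

Record homotopy_retract (C D : chain_complex) := HomotopyRetract {
  hr_p : chain_map C D;
  hr_i : chain_map D C;
  hr_quasi_iso : quasi_iso hr_i;
  hr_h : ghom 1 C C;
  hr_homotopy : forall k (x : C k),
    gcomp hr_i hr_p k k x - x =
    gcomp (cc_diff C) hr_h k k x + gcomp hr_h (cc_diff C) k k x
}.

Record multicomplex_data := MulticomplexData {
  mc_carrier :> graded;
  mc_op : forall n : nat, ghom (2 * n%:Z - 1) mc_carrier mc_carrier
}.

Definition multicomplex_axiom (A : multicomplex_data) : Prop :=
  forall (n : nat) i j (x : A i),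
    \sum_(l < n.+1) gcomp (mc_op A l) (mc_op A (n - l)) i j x = 0.

Record multicomplex := Multicomplex {
  mc_data :> multicomplex_data;
  mc_axiom : multicomplex_axiom mc_data
}.

Lemma deg0_subproof : 2 * 0%:Z - 1 = -1 :> int.
Proof. by []. Qed.

Definition mc_diff (A : multicomplex_data) : ghom (-1) A A :=
  gcast deg0_subproof (mc_op A 0).

Lemma mc_diff2 (A : multicomplex) i j x :
  gcomp (mc_diff A) (mc_diff A) i j x = 0.
Proof. by have := @mc_axiom A 0 i j x; rewrite big_ord1. Qed.

Definition mc_complex (A : multicomplex) : chain_complex :=
  ChainComplex (@mc_diff2 A).

Definition minimal (A : multicomplex) : Prop :=
  forall i j (x : A i), mc_op A 0 i j x = 0.

Definition acyclic (A : multicomplex) : Prop :=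
  forall k (c : homology (mc_complex A) k), c = 0.

Definition trivial (A : multicomplex) : Prop :=
  forall n : nat, (0 < n)%N -> forall i j (x : A i), mc_op A n i j x = 0.

Record infty_morphism (A B : multicomplex) := InftyMorphism {
  im_map :> forall n : nat, ghom (2 * n%:Z) A B;
  im_comm : forall (n : nat) i j (x : A i),
    \sum_(l < n.+1) gcomp (im_map (n - l)) (mc_op A l) i j x =
    \sum_(l < n.+1) gcomp (mc_op B (n - l)) (im_map l) i j x
}.

Definition infty_isomorphism (A B : multicomplex) (f : infty_morphism A B) :
  Prop := forall k, bijective (f 0 k k).

Section Product.
Variables A B : multicomplex.

Definition prod_carrier : graded := fun k => (A k * B k)%type.

Section Op.
Variable n : nat.

Definition prod_op_fun i j (x : prod_carrier i) : prod_carrier j :=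
  (mc_op A n i j x.1, mc_op B n i j x.2).

Lemma prod_op_linear i j : linear (@prod_op_fun i j).
Proof. by move=> a x y; rewrite /prod_op_fun !linearP. Qed.
HB.instance Definition _ i j := GRing.isLinear.Build K (prod_carrier i)
  (prod_carrier j) *:%R (@prod_op_fun i j) (@prod_op_linear i j).

Definition prod_op : ghom (2 * n%:Z - 1) prod_carrier prod_carrier.
Proof.
exists (fun i j => @prod_op_fun i j : {linear _ -> _}) => i j ne x /=.
by rewrite /prod_op_fun !ghom_deg.
Defined.
End Op.

Lemma product_subproof : multicomplex_axiom (MulticomplexData prod_op).
Proof.
move=> n i j [x y]; apply: injective_projections.
  by rewrite (big_morph fst (id1 := 0) (op1 := +%R)) //; exact: mc_axiom.
by rewrite (big_morph snd (id1 := 0) (op1 := +%R)) //; exact: mc_axiom.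
Qed.

Definition product : multicomplex := Multicomplex product_subproof.

End Product.

Section Transfer.
Variables (A : multicomplex).
Variable r : homotopy_retract (mc_complex A) (homology_complex (mc_complex A)).

Let H : graded := homology (mc_complex A).
Let h : ghom 1 A A := hr_h r.

Lemma zigzag_subproof1 n : 2 * n%:Z - 1 = 2 * (sumn [:: n])%:Z - 1 :> int.
Proof. by rewrite /= addn0. Qed.

Lemma zigzag_subproof2 n m s :
  (2 * (sumn (m :: s))%:Z - 1) + 1 + (2 * n%:Z - 1) =
  2 * (sumn [:: n, m & s])%:Z - 1 :> int.
Proof. by rewrite subrK addrA -mulrDr -PoszD addnC. Qed.

(* zigzag i1 [:: i2; ...; ik] is Delta_i1 h Delta_i2 h ... h Delta_ik.        *)
Fixpoint zigzag (n : nat) (s : seq nat) {struct s} :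
    ghom (2 * (sumn (n :: s))%:Z - 1) A A :=
  match s with
  | [::] => gcast (zigzag_subproof1 n) (mc_op A n)
  | m :: s' => gcast (zigzag_subproof2 n m s')
                 (gcomp (mc_op A n) (gcomp h (zigzag m s')))
  end.

Definition transfer_term (n : nat) (s : seq nat) :=
  gcomp (hr_p r : ghom 0 A H)
    (gcomp (zigzag n s) (hr_i r : ghom 0 H A)).

(* The tuple of length k + 1 stands for (i_1, ..., i_(k+1)).  Its entries are *)
(* positive with sum n, so that their number is at most n and each of them is *)
(* at most n; for n = 0 the sum is empty and the operator is 0.               *)
Definition transfer_fun (n : nat) i j (x : H i) : H j :=
  \sum_(k < n)
    \sum_(t : k.+1.-tuple 'I_n.+1 | all (fun m : 'I_n.+1 => (0 < m)%N) t &&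
                                    (sumn (map val t) == n))
      transfer_term (thead t) (map val (behead t)) i j x.

Lemma transfer_linear n i j : linear (@transfer_fun n i j).
Proof.
move=> a x y; rewrite /transfer_fun scaler_sumr -big_split /=.
apply: eq_bigr => k _; rewrite scaler_sumr -big_split /=.
by apply: eq_bigr => t _; rewrite !linearP.
Qed.
HB.instance Definition _ n i j := GRing.isLinear.Build K (H i) (H j) *:%R
  (@transfer_fun n i j) (@transfer_linear n i j).

Definition transfer_op (n : nat) : ghom (2 * n%:Z - 1) H H.
Proof.
exists (fun i j => @transfer_fun n i j : {linear _ -> _}) => i j ne x /=.
rewrite /transfer_fun big1 // => k _; apply: big1 => t /andP[_ /eqP st].
apply: ghom_deg; apply: contra ne; rewrite add0r addr0.
by move: st; rewrite {1}(tuple_eta t) /= => ->.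
Defined.

Definition transferred : multicomplex_data := MulticomplexData transfer_op.

End Transfer.
End Graded.

(* Main.v *)
From HB Require Import structures.
Require Import Defs.
From mathcomp Require Import all_boot all_order all_algebra.
From mathcomp Require Import boolp classical_sets functions zify.

(** The operators of a multicomplex A are the coefficients of a single
    differential D = d + t, with t = Delta_1 z + Delta_2 z^2 + ..., on the
    formal power series in z with coefficients in A: the multicomplex axiom
    says exactly D^2 = 0, and an oo-morphism is a series of maps that commutes
    with the differentials.  So t is a small perturbation of d, and the theorem
    is a statement of homological perturbation theory.

    Over a field a retract (p, i, h) onto homology exists
    ([homology_retract_exists]): take a degree 1 map s with d s d = d and set
    i p = (1 - d s)(1 - s d).  Let S = t + t h t + t h t h t + ..., whose
    coefficients are sums of zigzags, so that p S i is the transferred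
    structure ([series_act_transfer]).  The identity
    S i p S = - (S d + d S) ([resolvent_quadratic]), a consequence of D^2 = 0
    and dh + hd = ip - 1, gives both (p S i)^2 = 0, hence the multicomplex
    axiom on H(A), and the fact that p + p S h intertwines D with p S i
    ([transferred_projection]), hence an oo-morphism from A to H(A) that
    extends p.

    The acyclic factor is K = ker p with the differential d alone.  Let
    q = 1 - i p.  Since i is a quasi-isomorphism, p i = 1 ([retract_pi]), so
    that q is a projection of A onto K.  The series
    - (d (q h) + (q h) D) = q - q h t is null-homotopic, hence commutes with
    the differentials D and d, and extends q to an oo-morphism from A to K
    ([complement_perturbation]).  The pair of these two oo-morphisms has (p, q)
    as its term of order 0, which is bijective because p i = 1
    ([splitting_iso]). *)

Set Implicit Arguments.
Unset Strict Implicit.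
Unset Printing Implicit Defensive.

Import GRing.Theory.
Local Open Scope ring_scope.

(** * The homological perturbation lemma *)

Section PerturbationLemma.
Variables (V W : zmodType) (d t h S : {additive V -> V}).
Variables (p : {additive V -> W}) (i : {additive W -> V}).
Hypothesis diff_perturbed : forall x, d (t x) + t (d x) + t (t x) = 0.
Hypothesis homotopy : forall x, d (h x) + h (d x) = i (p x) - x.
Hypothesis resolvent_l : forall x, S x = t x + t (h (S x)).
Hypothesis resolvent_r : forall x, S x = t x + S (h (t x)).

(** Since S = (1 + S h) t = t (1 + h S), multiplying dt + td + tt = 0 by
    1 + S h on the left and 1 + h S on the right gives
    S d + d S + S (d h + h d + 1) S = 0. *)
Lemma resolvent_quadratic x : S (i (p (S x))) = - (S (d x) + d (S x)).
Proof.
have ipE y : i (p y) = d (h y) + h (d y) + y by rewrite homotopy subrK.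
set y := x + h (S x).
have ty : t y = S x by rewrite raddfD/= -resolvent_l.
have := diff_perturbed y; rewrite ty => zero.
have {zero} : S (d y) + (d (S x) + S (h (d (S x)))) + S (S x) = 0.
  rewrite (resolvent_r (d y)) (resolvent_r (S x)).
  rewrite [LHS](AC (2*2*2) ((3*1*5)*(4*2*6)))/= zero add0r.
  by rewrite -!raddfD zero !raddf0.
move=> zero; apply/eqP; rewrite -addr_eq0 -zero ipE /y !raddfD /=.
by rewrite [X in X == _](AC (3*2) (((4*1)*(5*2))*3)).
Qed.

Hypothesis d_i : forall w, d (i w) = 0.
Hypothesis p_d : forall x, p (d x) = 0.

Lemma transferred_square w : p (S (i (p (S (i w))))) = 0.
Proof. by rewrite resolvent_quadratic d_i !raddf0 add0r raddfN/= p_d oppr0. Qed.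

(** The map p + p S h carries the perturbed differential d + t to p S i. *)
Lemma transferred_projection x :
  p (d x + t x) + p (S (h (d x + t x))) =
  p (S (i (p x + p (S (h x))))).
Proof using diff_perturbed homotopy resolvent_l resolvent_r p_d.
have ipE y : i (p y) = d (h y) + h (d y) + y by rewrite homotopy subrK.
rewrite (raddfD i)/= (raddfD S (i (p x)))/= resolvent_quadratic ipE.
rewrite !(raddfD, raddfN)/= !p_d.
rewrite add0r subr0 [RHS](ACl (1*4*2*3))/= subrr add0r.
by rewrite [in RHS](resolvent_r x) raddfD/= addrCA.
Qed.

Hypothesis p_i : forall w, p (i w) = w.

(** With c = 1 - i p, the map c - c h t carries d + t to d: up to sign it is
    d (c h) + (c h) (d + t), a homotopy of the zero map. *)
Lemma complement_perturbation x (c := fun y => y - i (p y)) :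
  d (d x) = 0 ->
  c (d x + t x) - c (h (t (d x + t x))) = d (c x - c (h (t x))).
Proof.
move=> ddx.
have cB y z : c y - c z = c (y - z).
  by rewrite /c (raddfB p)/= (raddfB i)/= !opprB [LHS](AC (2*2) ((1*4)*(3*2))).
have cD y z : c (y + z) = c y + c z.
  by rewrite /c (raddfD p)/= (raddfD i)/= opprD addrACA.
have dc y : d (c y) = d y by rewrite /c raddfB/= d_i subr0.
have cd y : c (d y) = d y by rewrite /c p_d raddf0 subr0.
have -> : t (d x + t x) = - d (t x).
  by apply/eqP; rewrite -addr_eq0 raddfD/= addrC addrA diff_perturbed.
rewrite raddfN/= cB opprK -addrA cD cd [RHS]raddfB/= !dc; congr (_ + _).
have -> : t x + h (d (t x)) = i (p (t x)) - d (h (t x)).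
  by apply/eqP; rewrite eq_sym subr_eq addrAC -addrA homotopy addrC subrK.
by rewrite -cB cd /c p_i subrr sub0r.
Qed.

End PerturbationLemma.

(** * Complements and pseudo-inverses over a field *)

Definition linear_set (F : fieldType) (V : lmodType F) (S : set V) : Prop :=
  forall a x y, S x -> S y -> S (a *: x + y).

(** A maximal linear set meeting S trivially exists by Zorn's lemma, and it is
    a complement: otherwise a vector outside the sum could be adjoined. *)
Lemma linear_complement (F : fieldType) (V : lmodType F) (S : set V) :
  S 0 -> linear_set S ->
  exists C : set V, [/\ linear_set C, forall x, C x -> S x -> x = 0 &
    forall v, exists s c, [/\ S s, C c & v = s + c]].
Proof.
move=> S0 linS.
pose P : set (set V) := fun C => linear_set C /\ forall x, C x -> S x -> x = 0.
have [G PG tG|M [[linM MS] maxM]] := @Zorn_bigcup V P.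
  split=> [a x y [X GX Xx] [Y GY Yy]|x [X GX Xx]]; last exact: (PG X GX).2.
  have [XY|YX] := tG X Y GX GY.
    by exists Y => //; apply: (PG Y GY).1 => //; apply: XY.
  by exists X => //; apply: (PG X GX).1 => //; apply: YX.
exists M; split=> // v; apply: contrapT => nv.
(* The empty set belongs to P: M is nonempty only by its maximality. *)
have M0 : M 0.
  apply: contrapT => nM0; apply: (maxM (fun x => x = 0)).
    split=> [x Mx|/(_ 0 erefl)//]; exfalso; apply: nM0.
    by have := linM (-1) x x Mx Mx; rewrite scaleN1r addNr.
  by split=> [a x y -> ->|x ->//]; rewrite scaler0 addr0.
apply: (maxM (fun z => exists a c, M c /\ z = a *: v + c)).
  split=> [c Mc|sub]; first by exists 0, c; rewrite scale0r add0r.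
  apply: nv; exists 0, v; split=> //; last by rewrite add0r.
  by apply: sub; exists 1, 0; rewrite scale1r addr0.
split=> [a _ _ [b [c [Mc ->]]] [b' [c' [Mc' ->]]]|z [a [c [Mc zE]]] Sz].
  exists (a * b + b'), (a *: c + c'); split; first exact: linM.
  by rewrite scalerDr scalerA scalerDl addrACA.
have [a0|an0] := eqVneq a 0.
  by apply: MS Sz; rewrite zE a0 scale0r add0r.
exfalso; apply: nv; exists (a^-1 *: z), (- a^-1 *: c); split.
- by rewrite -[_ *: z]addr0; apply: linS.
- by rewrite -[_ *: c]addr0; apply: linM.
- by rewrite zE scalerDr scalerA mulVf// scale1r scaleNr addrK.
Qed.

(** With W a complement of ker f and C a complement of im f, the value g v is
    the unique w in W such that v - f w lies in C. *)
Lemma linear_pseudoinverse (F : fieldType) (U V : lmodType F)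
    (f : {linear U -> V}) :
  exists g : {linear V -> U}, forall x, f (g (f x)) = f x.
Proof.
have [||W [linW Wker Wdec]] := @linear_complement F U (fun x => f x = 0).
- exact: linear0.
- by move=> a x y fx fy; rewrite linearP fx fy scaler0 addr0.
have [||C [linC Cim Cdec]] :=
  @linear_complement F V (fun y => exists x, f x = y).
- by exists 0; apply: linear0.
- by move=> a _ _ [x <-] [y <-]; exists (a *: x + y); rewrite linearP.
have linB (X : lmodType F) (S : set X) :
    linear_set S -> forall x y, S x -> S y -> S (x - y).
  by move=> linS x y Sx Sy; rewrite addrC -scaleN1r; apply: linS.
have solve v : {w | W w /\ C (v - f w)}.
  apply: cid; have [_ [c [[u <-] Cc ->]]] := Cdec v.
  have [s [w [fs Ww ->]]] := Wdec u; exists w; split=> //.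
  by rewrite linearD fs add0r addrC addKr.
pose g v := sval (solve v).
have gP v : W (g v) /\ C (v - f (g v)) := svalP (solve v).
have g_unique v w : W w -> C (v - f w) -> g v = w.
  move=> Ww Cw; have [Wg Cg] := gP v; apply/eqP; rewrite -subr_eq0; apply/eqP.
  apply: Wker; first exact: linB.
  apply: Cim; last by exists (g v - w).
  have := linB _ _ linC _ _ Cw Cg.
  by rewrite opprB [_ + (_ - v)]addrC subrKA linearB.
have lin_g : linear g.
  move=> a x y; have [Wx Cx] := gP x; have [Wy Cy] := gP y.
  apply: g_unique; first exact: linW.
  by rewrite linearP opprD addrACA -scalerBr; apply: linC.
pose gL := GRing.isLinear.Build F V U *:%R g lin_g.
exists (HB.pack_for {linear V -> U} g gL) => x /=.
apply/esym/eqP; rewrite -subr_eq0; apply/eqP; apply: Cim.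
  exact: (gP _).2.
by exists (x - g (f x)); rewrite linearB.
Qed.

(** * Graded maps as operators on formal power series *)

Section Series.
Variable F : fieldType.
Implicit Types A B C : graded F.

(** Homogeneous maps of all degrees act on this product of the components of
    A, so that they compose and add without any comparison of degrees. *)
Definition total A := forall i : int, A i.
HB.instance Definition _ A := gen_eqMixin (total A).
HB.instance Definition _ A := gen_choiceMixin (total A).
Definition total_add A (x y : total A) : total A := fun i => x i + y i.
Definition total_opp A (x : total A) : total A := fun i => - x i.
Definition total_zero A : total A := fun=> 0.
Lemma total_addA A : associative (@total_add A).
Proof.
by move=> x y z; apply: functional_extensionality_dep => i; apply: addrA.
Qed.
Lemma total_addC A : commutative (@total_add A).
Proof.
by move=> x y; apply: functional_extensionality_dep => i; apply: addrC.
Qed.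
Lemma total_add0 A : left_id (@total_zero A) (@total_add A).
Proof.
by move=> x; apply: functional_extensionality_dep => i; apply: add0r.
Qed.
Lemma total_addN A : left_inverse (@total_zero A) (@total_opp A) (@total_add A).
Proof.
by move=> x; apply: functional_extensionality_dep => i; apply: addNr.
Qed.
HB.instance Definition _ A := GRing.isZmodule.Build (total A)
  (@total_addA A) (@total_addC A) (@total_add0 A) (@total_addN A).

Lemma total_sumE A I (r : seq I) (P : pred I) (x : I -> total A) i :
  (\sum_(k <- r | P k) x k) i = \sum_(k <- r | P k) x k i.
Proof. by elim/big_rec2: _ => // k a b _ <-. Qed.

Definition total_act d A B (f : ghom d A B) (x : total A) : total B :=
  fun j => f (j - d) j (x (j - d)).

Lemma total_act_additive d A B (f : ghom d A B) : zmod_morphism (total_act f).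
Proof.
move=> x y; apply: functional_extensionality_dep => j.
exact: (linearB (f (j - d) j)).
Qed.
HB.instance Definition _ d A B (f : ghom d A B) :=
  GRing.isZmodMorphism.Build _ _ (total_act f) (total_act_additive f).

Lemma total_actE d A B (f : ghom d A B) (x : total A) i j :
  j = i + d -> total_act f x j = f i j (x i).
Proof. by move=> ->; rewrite /total_act addrK. Qed.

Lemma total_act_gcomp d e A B C (g : ghom e B C) (f : ghom d A B) x :
  total_act (gcomp g f) x = total_act g (total_act f x).
Proof.
apply: functional_extensionality_dep => j.
set i := j - (d + e); have -> : j = i + d + e by rewrite -addrA subrK.
rewrite (@total_actE _ _ _ _ _ i) ?addrA// (@total_actE _ _ _ g _ (i + d))//.
by rewrite (@total_actE _ _ _ f _ i).
Qed.

Lemma total_act_eq d e A B (f : ghom d A B) (g : ghom e A B) x :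
  d = e -> (forall i j y, f i j y = g i j y) -> total_act f x = total_act g x.
Proof.
move=> de fg; apply: functional_extensionality_dep => j.
by rewrite /total_act fg de.
Qed.

Lemma total_act_gcast d e A B (de : d = e) (f : ghom d A B) x :
  total_act (gcast de f) x = total_act f x.
Proof. by apply: total_act_eq. Qed.

Lemma total_act_gzero d A B x : total_act (gzero d A B) x = 0.
Proof. by apply: functional_extensionality_dep. Qed.

Definition single A i (x : A i) : total A :=
  dfwith (fun j => 0 : A j) x.

(** The action on the total space determines every component of a homogeneous
    map, also those between degrees where it vanishes. *)
Lemma total_act_single d A B (f : ghom d A B) i j (x : A i) :
  total_act f (single x) j = f i j x.
Proof.
rewrite /total_act /single; have [ji|ji] := eqVneq i (j - d).
  by move: x; rewrite ji => x; rewrite dfwith_in.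
rewrite dfwith_out// linear0 ghom_deg//.
by apply: contra ji => /eqP->; rewrite addrK.
Qed.

Definition series A := nat -> total A.
HB.instance Definition _ A := GRing.Zmodule.on (series A).

Definition series_const A (x : total A) : series A :=
  fun n => if n is 0%N then x else 0.

Lemma series_constE A (x : total A) n : (0 < n)%N -> series_const x n = 0.
Proof. by case: n. Qed.

Section Act.
Variables (deg : nat -> int) (A B : graded F) (f : forall n, ghom (deg n) A B).

(** Multiplication by the power series with coefficients f n. *)
Definition series_act (x : series A) : series B :=
  fun n => \sum_(l < n.+1) total_act (f l) (x (n - l)%N).

Lemma series_act_additive : zmod_morphism series_act.
Proof.
move=> x y; apply/funext => n; rewrite /series_act.
rewrite -[RHS]/(_ - _) -sumrB; apply: eq_bigr => l _; exact: raddfB.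
Qed.
HB.instance Definition _ :=
  GRing.isZmodMorphism.Build _ _ series_act series_act_additive.

Lemma series_act_const x n :
  series_act (series_const x) n = total_act (f n) x.
Proof.
rewrite /series_act big_ord_recr/= subnn big1 ?add0r// => l _.
by rewrite series_constE ?raddf0// subn_gt0.
Qed.
End Act.

Section Levelwise.
Variables (e : int) (A B : graded F) (f : ghom e A B).
Definition series_map (x : series A) : series B := fun n => total_act f (x n).

Lemma series_map_additive : zmod_morphism series_map.
Proof. by move=> x y; apply/funext => n; exact: raddfB. Qed.
HB.instance Definition _ :=
  GRing.isZmodMorphism.Build _ _ series_map series_map_additive.
End Levelwise.

(** The sums of compositions in the definitions of multicomplexes and
    oo-morphisms are the coefficients of products of power series. *)
Lemma series_act_comp_single degf degg A B C (f : forall n, ghom (degf n) B C)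
    (g : forall n, ghom (degg n) A B) n i j (x : A i) :
  series_act f (series_act g (series_const (single x))) n j =
  \sum_(l < n.+1) gcomp (f l) (g (n - l)%N) i j x.
Proof.
rewrite [series_act f]/series_act total_sumE; apply: eq_bigr => l _.
by rewrite series_act_const -total_act_gcomp total_act_single.
Qed.

Definition gid_fun A i j (x : A i) : A j := single x j.
Lemma gid_linear A i j : linear (@gid_fun A i j).
Proof.
move=> a x y; rewrite /gid_fun /single; have [ij|ne] := eqVneq i j.
  by move: x y; rewrite ij => x y; rewrite !dfwith_in.
by rewrite !dfwith_out// scaler0 addr0.
Qed.
HB.instance Definition _ A i j := GRing.isLinear.Build F (A i) (A j)
  *:%R (@gid_fun A i j) (@gid_linear A i j).

Definition gid A : ghom 0 A A.
Proof.
exists (fun i j => @gid_fun A i j : {linear A i -> A j}) => i j ne x.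
by rewrite /= /gid_fun /single dfwith_out// eq_sym -[i]addr0.
Defined.

Lemma gidE A i (x : A i) : gid A i i x = x.
Proof. exact: dfwith_in. Qed.

Section HomOperations.
Variables (e : int) (A B : graded F).

Definition gadd (f g : ghom e A B) : ghom e A B.
Proof.
exists (fun i j => f i j \+ g i j : {linear A i -> B j}) => i j ne x /=.
by rewrite !ghom_deg// addr0.
Defined.

Definition gopp (f : ghom e A B) : ghom e A B.
Proof.
exists (fun i j => \- f i j : {linear A i -> B j}) => i j ne x /=.
by rewrite ghom_deg// oppr0.
Defined.

Definition order0 (f : ghom e A B) (n : nat) : ghom (2 * n%:Z + e) A B.
Proof.
exists (fun i j => if n == 0%N then f i j else \0 : {linear A i -> B j}).
by case: n => [|n] i j ne x //; apply: ghom_deg; rewrite -[e]add0r.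
Defined.

Lemma series_act_order0 f x : series_act (order0 f) x = series_map f x.
Proof.
apply/funext => n; rewrite /series_act big_ord_recl big1 ?addr0 => [|l _].
  by rewrite subn0; apply: total_act_eq => //; rewrite add0r.
exact: functional_extensionality_dep.
Qed.

End HomOperations.

Lemma series_act_gadd (deg : nat -> int) A B
    (f g : forall n, ghom (deg n) A B) x :
  series_act (fun n => gadd (f n) (g n)) x = series_act f x + series_act g x.
Proof. by apply/funext => n; rewrite -[RHS]/(_ + _) -big_split. Qed.

Lemma series_act_gcompl (deg : nat -> int) e A B C (g : ghom e B C)
    (f : forall n, ghom (deg n) A B) x :
  series_act (fun n => gcomp g (f n)) x = series_map g (series_act f x).
Proof.
apply/funext => n; rewrite /series_map raddf_sum; apply: eq_bigr => l _.
exact: total_act_gcomp.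
Qed.

Lemma series_act_gcompr (deg : nat -> int) e A B C
    (f : forall n, ghom (deg n) B C) (g : ghom e A B) x :
  series_act (fun n => gcomp (f n) g) x = series_act f (series_map g x).
Proof.
by apply/funext => n; apply: eq_bigr => l _; apply: total_act_gcomp.
Qed.

Lemma series_act_gcast (deg deg' : nat -> int) A B
    (degE : forall n, deg n = deg' n) (f : forall n, ghom (deg n) A B) x :
  series_act (fun n => gcast (degE n) (f n)) x = series_act f x.
Proof.
by apply/funext => n; apply: eq_bigr => l _; rewrite total_act_gcast.
Qed.

End Series.

(** * A homotopy retract onto homology *)

Section Retract.
Variables (F : fieldType) (C : chain_complex F).
Local Notation d := (cc_diff C).
Local Notation H := (homology C).

Lemma diff_diff i j k x : d j k (d i j x) = 0.
Proof.
have [->|ne] := eqVneq j (i - 1); last by rewrite (ghom_deg d ne) linear0.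
exact: (@cc_diff2 _ C i k x).
Qed.

(** Pseudo-inverses are chosen for the components of d between all pairs of
    degrees at once, so that they can be indexed like those of a graded map. *)
Lemma pseudoinverse_differential : exists s : ghom 1 C C,
  forall j x, d (j + 1) j (s j (j + 1) (d (j + 1) j x)) = d (j + 1) j x.
Proof.
have [s sP] : {s : forall i j, {linear C i -> C j} |
    forall i j x, d j i (s i j (d j i x)) = d j i x}.
  pose s i j := cid (linear_pseudoinverse (d j i)).
  by exists (fun i j => sval (s i j)) => i j x; exact: (svalP (s i j)).
have ne0 i j : j != i + 1 -> forall x,
    (if j == i + 1 then s i j else \0 : {linear C i -> C j}) x = 0.
  by move=> /negbTE->.
by exists (GHom ne0) => j x /=; rewrite eqxx sP.
Qed.

Section HomologyHom.
Variables (e : int) (B : graded F).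

Section Lift.
Variable f : ghom e B C.
Hypothesis df : forall i j x, d j (j - 1) (f i j x) = 0.
Lemma homology_lift_subproof i j x : f i j x \in ker_pred (d j (j - 1)).
Proof. by rewrite unfold_in df. Qed.
Definition homology_lift_fun i j (x : B i) : H j :=
  quot_class _ (KerType (homology_lift_subproof j x)).
Lemma homology_lift_linear i j : linear (@homology_lift_fun i j).
Proof.
move=> a x y; apply: etrans (_ : quot_class _
    (a *: KerType (homology_lift_subproof j x) +
     KerType (homology_lift_subproof j y)) = _); last first.
  by rewrite quot_classD quot_classZ.
by congr (quot_class _ _); apply: val_inj; rewrite /= linearP.
Qed.
HB.instance Definition _ i j := GRing.isLinear.Build F (B i) (H j) *:%R
  (@homology_lift_fun i j) (@homology_lift_linear i j).

Lemma homology_lift_boundary i j x u :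
  d (j + 1) j u = f i j x -> homology_lift_fun j x = 0.
Proof.
move=> du; rewrite -[RHS](linear0 (@homology_lift_fun i j)).
apply/quot_classP; rewrite unfold_in; apply/asboolP; exists u.
by rewrite du /= linear0 subr0.
Qed.

Definition homology_lift : ghom e B H.
Proof.
exists (fun i j => @homology_lift_fun i j : {linear _ -> _}) => i j ne x.
by apply: (@homology_lift_boundary _ _ _ 0); rewrite linear0 ghom_deg.
Defined.
End Lift.

Section Descent.
Variable f : ghom e C B.
Hypothesis fd : forall i j x, f i j (d (i + 1) i x) = 0.
Definition homology_descent_fun i j (c : H i) : B j :=
  f i j (val (quot_repr c)).

Lemma homology_descentE i j z :
  homology_descent_fun j (quot_class _ z : H i) = f i j (val z).
Proof.
rewrite /homology_descent_fun; set y := quot_repr _.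
apply/eqP; rewrite -subr_eq0 -linearB; apply/eqP.
have /quot_classP : quot_class (im_pred_submod (d (i + 1) i) (d i (i - 1))) y =
  quot_class _ z by rewrite quot_reprK.
by rewrite unfold_in => /asboolP[u du]; have := fd j u; rewrite du.
Qed.

Lemma homology_descent_linear i j : linear (@homology_descent_fun i j).
Proof.
move=> a x y; rewrite -[x]quot_reprK -[y]quot_reprK.
have -> : a *: quot_class _ (quot_repr x) + quot_class _ (quot_repr y) =
    quot_class _ (a *: quot_repr x + quot_repr y) :> H i.
  by rewrite quot_classD quot_classZ.
by rewrite !homology_descentE /= linearP.
Qed.
HB.instance Definition _ i j := GRing.isLinear.Build F (H i) (B j) *:%R
  (@homology_descent_fun i j) (@homology_descent_linear i j).
Definition homology_descent : ghom e H B.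
Proof.
exists (fun i j => @homology_descent_fun i j : {linear _ -> _}) => i j ne x.
exact: ghom_deg.
Defined.
End Descent.
End HomologyHom.

Section FromPseudoinverse.
Variable s : ghom 1 C C.
Hypothesis dsd : forall j x,
  d (j + 1) j (s j (j + 1) (d (j + 1) j x)) = d (j + 1) j x.

(** Since d s d = d, the map 1 - s d takes values in the cycles and 1 - d s
    vanishes on the boundaries.  So p is the class of (1 - s d) x and i is
    induced by 1 - d s. *)
Definition cycle_proj : ghom 0 C C := gadd (gid C) (gopp (gcomp s d)).
Definition boundary_coproj : ghom 0 C C := gadd (gid C) (gopp (gcomp d s)).
(** (1 - d s)(1 - s d) - 1 = - d s - s d + d s s d, and d h + h d for
    h = - s + s s d is the same sum, because d d = 0. *)
Definition pseudoinverse_h : ghom 1 C C := gadd (gopp s) (gcomp (gcomp s s) d).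

Lemma cycle_projE i x : cycle_proj i i x = x - s (i - 1) i (d i (i - 1) x).
Proof. by rewrite /= -[LHS]/(gid C i i x - _) gidE. Qed.

Lemma boundary_coprojE i x :
  boundary_coproj i i x = x - d (i + 1) i (s i (i + 1) x).
Proof. by rewrite /= -[LHS]/(gid C i i x - _) gidE. Qed.

Lemma sd_diff i x : d i (i - 1) (s (i - 1) i (d i (i - 1) x)) = d i (i - 1) x.
Proof. by have := @dsd (i - 1); rewrite subrK; apply. Qed.

Lemma diff_cycle_proj i j x : d j (j - 1) (cycle_proj i j x) = 0.
Proof.
have [->|ne] := eqVneq j i; last first.
  by rewrite (ghom_deg cycle_proj) ?linear0 ?addr0.
by rewrite cycle_projE linearB/= sd_diff subrr.
Qed.

Lemma boundary_coproj_diff i j x : boundary_coproj i j (d (i + 1) i x) = 0.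
Proof.
have [->|ne] := eqVneq j i; last by rewrite (ghom_deg boundary_coproj) ?addr0.
by rewrite boundary_coprojE dsd subrr.
Qed.

Definition pseudoinverse_p : ghom 0 C H := homology_lift diff_cycle_proj.
Definition pseudoinverse_i : ghom 0 H C :=
  homology_descent boundary_coproj_diff.

Lemma pseudoinverse_p_comm i j x :
  gcomp (cc_diff (homology_complex C)) pseudoinverse_p i j x =
  gcomp pseudoinverse_p d i j x.
Proof.
apply/esym; have [ij|ne] := eqVneq i (j + 1); last first.
  by apply: ghom_deg; apply: contra ne => /eqP->; rewrite addr0 subrK.
subst i; apply: (@homology_lift_boundary _ _ _ _ _ _ _ x).
by rewrite addrK cycle_projE diff_diff linear0 subr0.
Qed.

Lemma pseudoinverse_hE i j m x : j = i + 1 -> i = m + 1 ->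
  pseudoinverse_h i j x = - s i j x + s i j (s m i (d i m x)).
Proof.
move=> ji im; congr (_ + _).
rewrite (@gcompE _ _ _ _ _ _ _ _ _ m); last by rewrite im addrK.
by apply: gcompE.
Qed.

Lemma pseudoinverse_homotopy k (x : C k) :
  gcomp pseudoinverse_i pseudoinverse_p k k x - x =
  gcomp d pseudoinverse_h k k x + gcomp pseudoinverse_h d k k x.
Proof.
rewrite (@gcompE _ _ _ _ _ _ _ _ _ k) ?addr0//.
rewrite [X in X - _](homology_descentE boundary_coproj_diff).
rewrite -[val _]/(cycle_proj k k x) boundary_coprojE cycle_projE.
rewrite (@gcompE _ _ _ _ _ _ _ _ _ (k + 1))//.
rewrite (@gcompE _ _ _ _ _ _ _ _ _ (k - 1))//.
rewrite (pseudoinverse_hE (m := k - 1)) ?subrK//.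
rewrite (pseudoinverse_hE (m := k - 1 - 1)) ?subrK// diff_diff !linear0 addr0.
rewrite (linearB (s k (k + 1)))/= (linearB (d (k + 1) k))/=.
rewrite (linearD (d (k + 1) k)) (linearN (d (k + 1) k))/= opprB.
by rewrite [LHS](AC (2*2*1) ((1*5)*((4*3)*2)))/= subrr add0r.
Qed.

Lemma pseudoinverse_i_comm i j x :
  gcomp d pseudoinverse_i i j x =
  gcomp pseudoinverse_i (cc_diff (homology_complex C)) i j x.
Proof.
apply: etrans (esym (linear0 _)).
rewrite (@gcompE _ _ _ _ _ _ _ _ _ i) ?addr0//.
have := ker_valP (quot_repr x); rewrite unfold_in => /eqP dx.
have [->|ne] := eqVneq j (i - 1); last exact: ghom_deg.
rewrite /= -[X in d _ _ X]/(boundary_coproj i i _) boundary_coprojE.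
by rewrite linearB/= dx diff_diff subrr.
Qed.

Definition pseudoinverse_i_map : chain_map (homology_complex C) C :=
  @ChainMap _ (homology_complex C) C pseudoinverse_i pseudoinverse_i_comm.
Definition pseudoinverse_p_map : chain_map C (homology_complex C) :=
  @ChainMap _ C (homology_complex C) pseudoinverse_p pseudoinverse_p_comm.

(** The complex H has zero differential, so its homology is a copy of H: the
    class of c is c. Under this identification i induces the identity. *)
Lemma pseudoinverse_i_quasi_iso : quasi_iso pseudoinverse_i_map.
Proof.
move=> k.
have iE (b : homology (homology_complex C) k) :
    homology_map pseudoinverse_i_map b = val (quot_repr b).
  rewrite -[RHS]quot_reprK; apply/quot_classP.
  rewrite unfold_in; apply/asboolP; set z := quot_repr (val _).
  (* i z = z - d (s z) differs from the cycle z by a boundary. *)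
  exists (- s k (k + 1) (val z)).
  rewrite linearN; apply: (canRL (addrK _)).
  by rewrite addrC -boundary_coprojE.
pose H0 := homology_complex C.
pose g (c : H k) : homology H0 k := quot_class _
  (@KerType _ _ _ (cc_diff H0 k (k - 1)) c (eqxx (0 : H0 (k - 1)))).
exists g => [b|c].
  by rewrite iE -[RHS]quot_reprK; congr (quot_class _ _); apply: val_inj.
rewrite iE; have /quot_classP : quot_class (im_pred_submod
    (cc_diff H0 (k + 1) k) (cc_diff H0 k (k - 1))) (quot_repr (g c)) = g c.
  exact: quot_reprK.
rewrite unfold_in => /asboolP[u /= /esym/eqP].
by rewrite subr_eq0 => /eqP.
Qed.

Definition pseudoinverse_retract : homotopy_retract C (homology_complex C) :=
  @HomotopyRetract _ C (homology_complex C) pseudoinverse_p_map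
    pseudoinverse_i_map pseudoinverse_i_quasi_iso pseudoinverse_h
    pseudoinverse_homotopy.
End FromPseudoinverse.

Lemma homology_retract_exists :
  inhabited (homotopy_retract C (homology_complex C)).
Proof.
have [s dsd] := pseudoinverse_differential.
exact: (inhabits (pseudoinverse_retract dsd)).
Qed.
End Retract.

(** * Multicomplexes as perturbed differentials *)

Section Perturbation.
Variable F : fieldType.

Lemma sum_triangle (V : nmodType) n (G : nat -> nat -> V) :
  \sum_(l < n.+1) \sum_(m < (n - l).+1) G l m =
  \sum_(s < n.+1) \sum_(l < s.+1) G l (s - l)%N.
Proof.
transitivity (\sum_(l < n.+1) \sum_(s < n.+1 | (l <= s)%N) G l (s - l)%N).
  apply: eq_bigr => l _; rewrite -subSn ?leq_ord//.
  rewrite -(big_mkord xpredT (G l)).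
  rewrite -(big_mkord (fun s => l <= s)%N (fun s => G l (s - l)%N)).
  rewrite -(big_nat_widenl _ _ _ xpredT)// -[in RHS](add0n l) big_addn.
  by apply: eq_bigr => m _; rewrite addnK.
rewrite (exchange_big_dep xpredT)//=; apply: eq_bigr => s _.
by rewrite [RHS](big_ord_widen n.+1 (fun l => G l (s - l)%N)) ?ltn_ord.
Qed.

Section Multicomplex.
Variable A : multicomplex F.

(** The coefficients of the square of the differential are the sums in the
    multicomplex axiom. *)
Lemma series_act_square x :
  series_act (mc_op A) (series_act (mc_op A) x) = 0.
Proof.
apply/funext => n; rewrite /series_act.
under eq_bigr do rewrite raddf_sum.
pose G l m := total_act (mc_op A l) (total_act (mc_op A m) (x (n - (l + m))%N)).
rewrite (eq_bigr (fun l : 'I_n.+1 => \sum_(m < (n - l).+1) G l m)); last first.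
  by move=> l _; apply: eq_bigr => m _; rewrite /G subnDA.
rewrite (sum_triangle n G) /G.
apply: big1 => s _; apply: functional_extensionality_dep => j.
pose i : int := j - (2 * s%:Z - 1 - 1).
rewrite total_sumE -[RHS](@mc_axiom _ A s i j (x (n - s)%N i)).
apply: eq_bigr => l _; have ls : (l <= s)%N := leq_ord l.
rewrite subnKC// -total_act_gcomp; apply: total_actE.
by rewrite /i; lia.
Qed.

(** The coefficients of t = Delta_1 z + Delta_2 z^2 + ... *)
Definition perturbation n : ghom (2 * n%:Z - 1) A A :=
  if n == 0%N then gzero _ A A else mc_op A n.

Lemma series_act_split x : series_act (mc_op A) x =
  series_map (mc_diff A) x + series_act perturbation x.
Proof.
apply/funext => n; rewrite -[RHS]/(_ + _) /series_act !big_ord_recl/=.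
by rewrite total_act_gzero [X in _ = _ + X]add0r (subn0 n).
Qed.

Lemma perturbation_widen N x n : (n < N)%N ->
  series_act perturbation x n =
  \sum_(m < N | (0 < m)%N && (m <= n)%N) total_act (mc_op A m) (x (n - m)%N).
Proof.
move=> nN; rewrite /series_act.
rewrite (big_ord_widen N (fun m => total_act (perturbation m) (x (n - m)%N)))//.
rewrite big_mkcond [RHS]big_mkcond; apply: eq_bigr => m _ /=.
rewrite ltnS /perturbation lt0n; case: eqP => //= _.
by rewrite total_act_gzero if_same.
Qed.

Lemma perturbed_square x :
  series_map (mc_diff A) (series_act perturbation x) +
  series_act perturbation (series_map (mc_diff A) x) +
  series_act perturbation (series_act perturbation x) = 0.
Proof.
rewrite -(series_act_square x) !series_act_split raddfD raddfD/=.
rewrite -!addrA -[LHS]add0r; congr (_ + _).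
apply/funext => n; apply: functional_extensionality_dep => j.
rewrite /series_map -total_act_gcomp; symmetry; exact: mc_diff2.
Qed.

End Multicomplex.

Section Transfer.
Variable A : multicomplex F.
Variable r : homotopy_retract (mc_complex A) (homology_complex (mc_complex A)).
Local Notation H := (homology (mc_complex A)).
Local Notation d := (series_map (mc_diff A)).
Local Notation t := (series_act (perturbation A)).
Local Notation h := (@series_map _ 1 A A (hr_h r)).

(** The coefficients of (t h)^k t are the sums of the zigzags of length k + 1.
    Any bound N > n on the entries gives the same sum over tuples: the common
    bound lets the induction on k, which lowers n, keep one type of tuples. *)
Lemma iter_zigzag N k x n : (n < N)%N ->
  iter k (t \o h) (t x) n =
  \sum_(s : k.+1.-tuple 'I_N | all (fun m : 'I_N => (0 < m)%N) s &&
                               (sumn (map val s) <= n)%N)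
     total_act (zigzag r (thead s) (map val (behead s)))
       (x (n - sumn (map val s))%N).
Proof.
have sum_cons (V : nmodType) j (P : pred (j.+1.-tuple 'I_N))
    (G : j.+1.-tuple 'I_N -> V) :
    \sum_(s | P s) G s =
    \sum_(m < N) \sum_(s : j.-tuple 'I_N | P [tuple of m :: s])
      G [tuple of m :: s].
  rewrite pair_big_dep/=.
  rewrite (reindex (fun u : 'I_N * j.-tuple 'I_N => [tuple of u.1 :: u.2]))//=.
  exists (fun s => (thead s, [tuple of behead s])) => [[m s] _|s _] /=.
    by congr (_, _); apply: val_inj.
  by rewrite [RHS]tuple_eta.
elim: k n => [|k IH] n nN.
  rewrite /= (perturbation_widen _ nN) sum_cons big_mkcond/=.
  apply: eq_bigr => m _.
  rewrite (eq_bigl (fun s => (0 < m <= n)%N && (s == [tuple]))); last first.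
    by move=> s; rewrite tuple0 eqxx andbT/= addn0 andbT.
  case: ifP => mn; last by rewrite big_pred0.
  by rewrite /= big_pred1_eq/= total_act_gcast addn0.
rewrite iterS /= (perturbation_widen _ nN) sum_cons big_mkcond/=.
apply: eq_bigr => m _.
case: ifP => mn; last first.
  rewrite big_pred0// => s; apply: contraFF mn => /= /andP[/andP[-> _]] /=.
  exact/leq_trans/leq_addr.
rewrite /series_map /= IH; last by rewrite (leq_ltn_trans (leq_subr _ _)).
rewrite !raddf_sum; apply: eq_big => s.
  move: mn => /andP[-> mn] /=; congr (_ && _).
  by rewrite leq_subRL.
move=> _; case/tupleP: s => a s /=.
by rewrite total_act_gcast !total_act_gcomp theadE (subnDA m).
Qed.

(** The series t has no term of order 0, so (t h)^k t starts at order k + 1 and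
    the geometric series for S is a finite sum in each order. *)
Lemma iter_vanish k x n : (n <= k)%N -> iter k (t \o h) (t x) n = 0.
Proof.
elim: k n => [|k IH] n nk; rewrite ?iterS /= (perturbation_widen _ (ltnSn n)).
  move: nk; rewrite leqn0 => /eqP->.
  by apply: big1 => m /andP[/leq_trans/[apply]].
apply: big1 => m /andP[m0 mn]; rewrite /series_map IH ?raddf0//.
by rewrite leq_subLR (leq_trans nk)// -add1n leq_add2r.
Qed.

(** The coefficient of order n of S = t + t h t + t h t h t + ...: the operator
    transferred to homology in order n, before the maps p and i are applied. *)
Definition resolvent_fun n i j (x : A i) : A j :=
  \sum_(k < n)
    \sum_(s : k.+1.-tuple 'I_n.+1 | all (fun m : 'I_n.+1 => (0 < m)%N) s &&
                                    (sumn (map val s) == n))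
      zigzag r (thead s) (map val (behead s)) i j x.

Lemma resolvent_linear n i j : linear (@resolvent_fun n i j).
Proof.
move=> a x y; rewrite /resolvent_fun scaler_sumr -big_split /=.
apply: eq_bigr => k _; rewrite scaler_sumr -big_split /=.
by apply: eq_bigr => t _; rewrite !linearP.
Qed.
HB.instance Definition _ n i j := GRing.isLinear.Build F (A i) (A j) *:%R
  (@resolvent_fun n i j) (@resolvent_linear n i j).

Definition resolvent (n : nat) : ghom (2 * n%:Z - 1) A A.
Proof.
exists (fun i j => @resolvent_fun n i j : {linear A i -> A j}) => i j ne x /=.
rewrite /resolvent_fun big1 // => k _; apply: big1 => s /andP[_ /eqP ss].
apply: ghom_deg; apply: contra ne.
by move: ss; rewrite {1}(tuple_eta s) /= => ->.
Defined.

Lemma total_act_resolvent n x : total_act (resolvent n) x =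
  \sum_(k < n)
    \sum_(s : k.+1.-tuple 'I_n.+1 | all (fun m : 'I_n.+1 => (0 < m)%N) s &&
                                    (sumn (map val s) == n))
      total_act (zigzag r (thead s) (map val (behead s))) x.
Proof.
apply: functional_extensionality_dep => j; rewrite total_sumE.
apply: eq_bigr => k _; rewrite total_sumE; apply: eq_bigr => s /andP[_ /eqP ss].
rewrite [RHS](@total_actE _ _ _ _ _ _ (j - (2 * n%:Z - 1)))//.
by move: ss; rewrite {1}(tuple_eta s) /= => ->; rewrite subrK.
Qed.

(** On a constant series only the zigzags of total order exactly n contribute
    to order n; this isolates the coefficients of (t h)^k t. *)
Lemma iter_zigzag_const N k z n : (n < N)%N ->
  iter k (t \o h) (t (series_const z)) n =
  \sum_(s : k.+1.-tuple 'I_N | all (fun m : 'I_N => (0 < m)%N) s &&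
                               (sumn (map val s) == n))
     total_act (zigzag r (thead s) (map val (behead s))) z.
Proof.
move=> nN; rewrite (iter_zigzag _ _ nN) big_mkcond [RHS]big_mkcond.
apply: eq_bigr => s _; case: (all _ _) => //=.
case: (ltngtP (sumn (map val s)) n) => [sn|//|->]; last by rewrite subnn.
by rewrite series_constE ?raddf0// subn_gt0.
Qed.

Lemma iter_convolution k x n : iter k (t \o h) (t x) n =
  \sum_(l < n.+1) iter k (t \o h) (t (series_const (x (n - l)%N))) l.
Proof.
rewrite (iter_zigzag _ _ (ltnSn n)).
rewrite (partition_big (fun s : k.+1.-tuple 'I_n.+1 =>
  inord (sumn (map val s)) : 'I_n.+1) xpredT)//=.
apply: eq_bigr => l _; rewrite (iter_zigzag_const _ _ (ltn_ord l)).
apply: eq_big => s.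
  rewrite -andbA; congr (_ && _); apply/andP/eqP => [[sn /eqP <-]|sl].
    by rewrite inordK.
  by rewrite sl leq_ord -val_eqE/= inord_val.
by move=> /andP[/andP[_ sn] /eqP<-]; rewrite inordK.
Qed.

Lemma series_act_resolvent N x n : (n <= N)%N ->
  series_act resolvent x n = \sum_(k < N) iter k (t \o h) (t x) n.
Proof.
move=> nN; under [RHS]eq_bigr do rewrite iter_convolution.
rewrite exchange_big/=; apply: eq_bigr => l _; rewrite total_act_resolvent.
have lN : (l <= N)%N := leq_trans (leq_ord l) nN.
rewrite (eq_bigr _ (fun (k : 'I_l) _ =>
  esym (iter_zigzag_const k _ (ltnSn l)))).
rewrite (big_ord_widen N (fun k =>
  iter k (t \o h) (t (series_const (x (n - l)%N))) l))//.
rewrite big_mkcond; apply: eq_bigr => k _.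
by case: ltnP => // lk; rewrite iter_vanish.
Qed.

Lemma resolvent_left x :
  series_act resolvent x = t x + t (h (series_act resolvent x)).
Proof.
apply/funext => n; rewrite -[RHS]/(_ + _) (series_act_resolvent _ (leqnSn n)).
rewrite big_ord_recl; congr (_ + _).
rewrite (perturbation_widen _ (ltnSn n)).
transitivity (\sum_(m < n.+1 | (0 < m <= n)%N) \sum_(k < n)
    total_act (mc_op A m) (h (iter k (t \o h) (t x)) (n - m)%N)); last first.
  apply: eq_bigr => m _.
  by rewrite /series_map (series_act_resolvent _ (leq_subr m n)) !raddf_sum.
rewrite [RHS]exchange_big/=; apply: eq_bigr => k _.
rewrite -[LHS]/(t (h (iter k (t \o h) (t x))) n).
by rewrite (perturbation_widen _ (ltnSn n)).
Qed.

Lemma resolvent_right x :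
  series_act resolvent x = t x + series_act resolvent (h (t x)).
Proof.
apply/funext => n; rewrite -[RHS]/(_ + _) (series_act_resolvent _ (leqnSn n)).
rewrite big_ord_recl; congr (_ + _).
rewrite (series_act_resolvent _ (leqnn n)); apply: eq_bigr => k _.
by rewrite lift0 iterSr.
Qed.

Local Notation S := (series_act resolvent).
Local Notation p := (@series_map _ 0 A H (hr_p r)).
Local Notation i := (@series_map _ 0 H A (hr_i r)).

Lemma series_homotopy x : d (h x) + h (d x) = i (p x) - x.
Proof.
apply/funext => n; apply: functional_extensionality_dep => k.
have := hr_homotopy r (x n k); rewrite -!(@total_actE _ _ _ _ _ (x n)) ?addr0//.
by rewrite !total_act_gcomp.
Qed.

Lemma series_diff_i w : d (i w) = 0.
Proof.
apply/funext => n; rewrite /series_map -total_act_gcomp.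
apply: functional_extensionality_dep => k.
apply: etrans (@cm_comm _ _ _ (hr_i r) _ _ _) _; exact: linear0.
Qed.

Lemma series_p_diff x : p (d x) = 0.
Proof.
apply/funext => n; rewrite /series_map -total_act_gcomp.
apply: functional_extensionality_dep => k.
exact: esym (@cm_comm _ _ _ (hr_p r) _ _ _).
Qed.

Lemma series_act_transfer w : series_act (transfer_op r) w = p (S (i w)).
Proof.
apply/funext => n.
rewrite [RHS](raddf_sum (@total_act _ 0 A H (hr_p r))).
apply: eq_bigr => l _; rewrite /series_map -total_act_gcomp.
rewrite -[RHS](total_act_gcomp (hr_p r : ghom 0 A H) (gcomp (resolvent l) _)).
apply: total_act_eq => [|j k y] /=; first by rewrite add0r addr0.
rewrite /transfer_fun /resolvent_fun raddf_sum; apply: eq_bigr => m _.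
rewrite raddf_sum; apply: eq_bigr => s /andP[_ /eqP ss].
apply: gcompE; congr (j + (0 + _)).
by move: ss; rewrite {1}(tuple_eta s) /= => ->.
Qed.

Lemma transferred_axiom : multicomplex_axiom (transferred r).
Proof.
move=> n k j x; rewrite -series_act_comp_single !series_act_transfer.
rewrite (@transferred_square _ _ d t h S p i)//.
- exact: perturbed_square.
- exact: series_homotopy.
- exact: resolvent_left.
- exact: resolvent_right.
- exact: series_diff_i.
- exact: series_p_diff.
Qed.

End Transfer.

End Perturbation.

(** * Kernels, trivial multicomplexes and pairs of morphisms *)

Section Constructions.
Variable F : fieldType.

Lemma infty_morphism_comm (A B : multicomplex F)
    (f : forall n : nat, ghom (2 * n%:Z) A B) :
  (forall x, series_act f (series_act (mc_op A) x) =
             series_act (mc_op B) (series_act f x)) ->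
  forall (n : nat) i j (x : A i),
    \sum_(l < n.+1) gcomp (f (n - l)%N) (mc_op A l) i j x =
    \sum_(l < n.+1) gcomp (mc_op B (n - l)%N) (f l) i j x.
Proof.
move=> fD n i j x.
rewrite [LHS](reindex_inj rev_ord_inj) [RHS](reindex_inj rev_ord_inj)/=.
have /(congr1 (fun y : series B => y n j)) := fD (series_const (single x)).
rewrite !series_act_comp_single => E; apply: etrans (etrans _ E) _.
  by apply: eq_bigr => l _; rewrite subSS subKn ?leq_ord.
by apply: eq_bigr => l _; rewrite subSS subKn ?leq_ord.
Qed.

Section Kernel.
Variables (C D : chain_complex F) (p : chain_map C D).

Definition kernel : graded F := fun k => ker_type (p k k).

Section Lift.
Variables (e : int) (B : graded F) (f : ghom e B C).
Hypothesis pf : forall i j x, p j j (f i j x) = 0.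

Lemma kernel_lift_subproof i j x : f i j x \in ker_pred (p j j).
Proof. by rewrite unfold_in pf. Qed.
Definition kernel_lift_fun i j (x : B i) : kernel j :=
  KerType (kernel_lift_subproof j x).
Lemma kernel_lift_linear i j : linear (@kernel_lift_fun i j).
Proof. by move=> a x y; apply: val_inj; rewrite /= linearP. Qed.
HB.instance Definition _ i j := GRing.isLinear.Build F (B i) (kernel j) *:%R
  (@kernel_lift_fun i j) (@kernel_lift_linear i j).
Definition kernel_lift : ghom e B kernel.
Proof.
exists (fun i j => @kernel_lift_fun i j : {linear _ -> _}) => i j ne x.
by apply: val_inj; apply: ghom_deg.
Defined.
End Lift.

Definition kernel_restrict e B (f : ghom e C B) : ghom e kernel B.
Proof.
exists (fun i j => (f i j \o val) : {linear kernel i -> B j}) => i j ne x.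
exact: ghom_deg.
Defined.

Lemma kernel_diff_subproof i j x :
  p j j (kernel_restrict (cc_diff C) i j x) = 0.
Proof.
have [->|ne] := eqVneq j (i - 1); last first.
  by rewrite (ghom_deg (kernel_restrict _) ne) linear0.
rewrite -chain_map_comm; have := ker_valP x; rewrite unfold_in => /eqP->.
exact: linear0.
Qed.

Definition kernel_diff : ghom (-1) kernel kernel :=
  kernel_lift kernel_diff_subproof.

Lemma kernel_diff2 i j x : gcomp kernel_diff kernel_diff i j x = 0.
Proof. by apply: val_inj; apply: (@cc_diff2 _ C i j (val x)). Qed.

Definition kernel_complex : chain_complex F := ChainComplex kernel_diff2.

Definition kernel_incl (x : series kernel) : series C := fun n i => val (x n i).
Lemma kernel_incl_additive : zmod_morphism kernel_incl.
Proof.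
by move=> x y; apply/funext => n; apply: functional_extensionality_dep.
Qed.
HB.instance Definition _ :=
  GRing.isZmodMorphism.Build _ _ kernel_incl kernel_incl_additive.
Lemma kernel_incl_inj : injective kernel_incl.
Proof.
move=> x y xy; apply/funext => n; apply: functional_extensionality_dep => k.
by apply: val_inj; rewrite -[LHS]/(kernel_incl x n k) xy.
Qed.

End Kernel.

Section TrivialMulticomplex.
Variable C : chain_complex F.

Lemma trivial_axiom :
  multicomplex_axiom (MulticomplexData (order0 (cc_diff C))).
Proof.
move=> n i j x; rewrite -series_act_comp_single !series_act_order0.
rewrite /series_map -total_act_gcomp; apply: cc_diff2.
Qed.

Definition trivial_multicomplex : multicomplex F := Multicomplex trivial_axiom.

Lemma trivial_multicomplexP : trivial trivial_multicomplex.
Proof. by case. Qed.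

End TrivialMulticomplex.

Section Pairing.
Variables (A B C : multicomplex F).
Variables (f : infty_morphism A B) (g : infty_morphism A C).

Section Op.
Variable n : nat.
Definition pairing_fun i j (x : A i) : product B C j := (f n i j x, g n i j x).
Lemma pairing_linear i j : linear (@pairing_fun i j).
Proof. by move=> a x y; rewrite /pairing_fun !linearP. Qed.
HB.instance Definition _ i j := GRing.isLinear.Build F (A i)
  (product B C j) *:%R (@pairing_fun i j) (@pairing_linear i j).
Definition pairing_op : ghom (2 * n%:Z) A (product B C).
Proof.
exists (fun i j => @pairing_fun i j : {linear _ -> _}) => i j ne x /=.
by rewrite /pairing_fun !ghom_deg.
Defined.
End Op.

Lemma pairing_comm (n : nat) i j (x : A i) :
  \sum_(l < n.+1) gcomp (pairing_op (n - l)) (mc_op A l) i j x =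
  \sum_(l < n.+1) gcomp (mc_op (product B C) (n - l)) (pairing_op l) i j x.
Proof.
apply: injective_projections.
  rewrite !(big_morph fst (id1 := 0) (op1 := +%R))//; exact: (im_comm f).
rewrite !(big_morph snd (id1 := 0) (op1 := +%R))//; exact: (im_comm g).
Qed.

Definition pairing : infty_morphism A (product B C) :=
  InftyMorphism pairing_comm.

End Pairing.

End Constructions.

(** * The splitting *)

Section Splitting.
Variables (F : fieldType) (A : multicomplex F).
Variable r : homotopy_retract (mc_complex A) (homology_complex (mc_complex A)).
Local Notation H := (homology (mc_complex A)).
Local Notation p := (hr_p r : ghom 0 A H).
Local Notation i := (hr_i r : ghom 0 H A).
Local Notation h := (hr_h r : ghom 1 A A).
Local Notation d := (mc_diff A).

Lemma retract_homotopy k (x : A k) :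
  d (k + 1) k (h k (k + 1) x) + h (k - 1) k (d k (k - 1) x) =
  i k k (p k k x) - x.
Proof.
by have := hr_homotopy r x; rewrite (@gcompE _ _ _ _ _ _ _ _ k k) ?addr0.
Qed.

Lemma retract_i_cycle k j (c : H k) : d k j (i k k c) = 0.
Proof.
have [->|ne] := eqVneq j (k - 1); last exact: ghom_deg.
apply: etrans (chain_map_comm (hr_i r) c) _; exact: linear0.
Qed.

(** By the homotopy, i (p i - 1) = d h i takes values in the boundaries, and i
    is injective on homology, that is, modulo boundaries. *)
Lemma retract_pi k (c : H k) : p k k (i k k c) = c.
Proof.
set z : H k := p k k (i k k c) - c.
have iz : i k k z = d (k + 1) k (h k (k + 1) (i k k c)).
  by rewrite linearB -retract_homotopy retract_i_cycle linear0 addr0.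
pose H0 := homology_complex (mc_complex A).
have zK : z \in ker_pred (cc_diff H0 k (k - 1)).
  by rewrite unfold_in.
have [g gK _] := hr_quasi_iso r k.
suff : quot_class (im_pred_submod (cc_diff H0 (k + 1) k)
    (cc_diff H0 k (k - 1))) (KerType zK) = quot_class _ 0.
  move=> /quot_classP; rewrite unfold_in => /asboolP[u /= /esym zE].
  by apply/eqP; rewrite -subr_eq0; apply/eqP; rewrite subr0 in zE.
apply: (can_inj gK); rewrite !homology_mapE; apply/quot_classP.
rewrite unfold_in; apply/asboolP; exists (h k (k + 1) (i k k c)).
by rewrite /= linear0 subr0 iz.
Qed.

(** This is 1 - i p, written as - (h d + d h): in this form its components
    between different degrees need no separate definition. *)
Definition complement_proj : ghom 0 A A := gopp (gadd (gcomp h d) (gcomp d h)).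

Lemma complement_projE k (x : A k) :
  complement_proj k k x = x - i k k (p k k x).
Proof.
rewrite -[RHS]opprB -retract_homotopy; congr (- _).
by rewrite /= addrC.
Qed.

Lemma retract_p_complement k j (x : A k) :
  hr_p r j j (complement_proj k j x) = 0.
Proof.
have [->|ne] := eqVneq j k; last first.
  by rewrite (ghom_deg complement_proj) ?linear0 ?addr0.
by rewrite complement_projE linearB/= retract_pi subrr.
Qed.

Definition to_kernel : ghom 0 A (kernel (hr_p r)) :=
  kernel_lift retract_p_complement.

Definition kernel_part := trivial_multicomplex (kernel_complex (hr_p r)).

Definition order0_map (B : graded F) (f : ghom 0 A B) n : ghom (2 * n%:Z) A B :=
  gcast (addr0 _) (order0 f n).

Lemma kernel_op_degree n : (2 * n%:Z - 1 + 1) + 0 = 2 * n%:Z :> int.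
Proof. by rewrite addr0 subrK. Qed.

Lemma homology_op_degree n : (1 + (2 * n%:Z - 1)) + 0 = 2 * n%:Z :> int.
Proof. by rewrite addr0 addrC subrK. Qed.

(** The coefficients of q - q h t, where q = 1 - i p has values in ker p. *)
Definition kernel_op n : ghom (2 * n%:Z) A (kernel (hr_p r)) :=
  gadd (order0_map to_kernel n)
    (gcast (kernel_op_degree n)
      (gcomp (gopp to_kernel) (gcomp h (perturbation A n)))).

(** The coefficients of p + p S h. *)
Definition homology_op n : ghom (2 * n%:Z) A H :=
  gadd (order0_map p n)
    (gcast (homology_op_degree n) (gcomp p (gcomp (resolvent r n) h))).

Lemma series_kernel_op x : series_act kernel_op x =
  series_map to_kernel x -
  series_map to_kernel (series_map h (series_act (perturbation A) x)).
Proof.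
rewrite series_act_gadd !series_act_gcast series_act_order0.
by rewrite !series_act_gcompl.
Qed.

Lemma series_homology_op x : series_act homology_op x =
  series_map p x + series_map p (series_act (resolvent r) (series_map h x)).
Proof.
rewrite series_act_gadd !series_act_gcast series_act_order0.
by rewrite !series_act_gcompl series_act_gcompr.
Qed.

Lemma kernel_incl_to_kernel x : kernel_incl (series_map to_kernel x) =
  x - series_map i (series_map p x).
Proof.
apply/funext => n; apply: functional_extensionality_dep => k.
transitivity (total_act complement_proj (x n) k) => //.
rewrite (@total_actE _ _ _ _ _ _ k) ?addr0// complement_projE.
by rewrite -[RHS]/(_ - _) /series_map !(@total_actE _ _ _ _ _ _ k) ?addr0.
Qed.

Lemma kernel_incl_diff x :
  kernel_incl (series_map (kernel_diff (hr_p r)) x) =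
  series_map d (kernel_incl x).
Proof. by []. Qed.

Lemma kernel_op_comm x :
  series_act kernel_op (series_act (mc_op A) x) =
  series_act (mc_op kernel_part) (series_act kernel_op x).
Proof.
apply: kernel_incl_inj.
rewrite [series_act (mc_op kernel_part) _]series_act_order0.
have inclE y : kernel_incl (series_act kernel_op y) =
    y - series_map i (series_map p y) -
    (series_map h (series_act (perturbation A) y) -
     series_map i
       (series_map p (series_map h (series_act (perturbation A) y)))).
  by rewrite series_kernel_op -!kernel_incl_to_kernel; apply: raddfB.
rewrite kernel_incl_diff !inclE series_act_split.
apply: (complement_perturbation (h := series_map h)) => [y|y|w|y|w|].
- exact: perturbed_square.
- exact: series_homotopy.
- exact: series_diff_i.
- exact: series_p_diff.
- apply/funext => n; apply: functional_extensionality_dep => k.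
  by rewrite /= /series_map !(@total_actE _ _ _ _ _ _ k) ?addr0 ?retract_pi.
- apply/funext => n; apply: functional_extensionality_dep => k.
  by rewrite /= /series_map -total_act_gcomp; apply: mc_diff2.
Qed.

Definition kernel_morphism : infty_morphism A kernel_part :=
  InftyMorphism (@infty_morphism_comm _ A kernel_part kernel_op kernel_op_comm).

Definition homology_part := Multicomplex (@transferred_axiom _ _ r).

Lemma homology_op_comm x :
  series_act homology_op (series_act (mc_op A) x) =
  series_act (mc_op homology_part) (series_act homology_op x).
Proof.
rewrite [series_act (mc_op homology_part) _]series_act_transfer.
rewrite !series_homology_op series_act_split.
apply: transferred_projection.
- exact: perturbed_square.
- exact: series_homotopy.
- exact: resolvent_left.
- exact: resolvent_right.
- exact: series_p_diff.
Qed.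

Definition homology_morphism : infty_morphism A homology_part :=
  InftyMorphism
    (@infty_morphism_comm _ A homology_part homology_op homology_op_comm).

Lemma homology_part_minimal : minimal homology_part.
Proof. by move=> k j x; rewrite /= /transfer_fun big_ord0. Qed.

(** A cycle x of ker p is the boundary of - q h x: d q = d since d i = 0, and
    the homotopy reads d h x = - x because p x = 0 and d x = 0. *)
Lemma kernel_part_acyclic : acyclic kernel_part.
Proof.
move=> k c.
suff all0 (b : homology (mc_complex kernel_part) k) : b = quot_class _ 0.
  by rewrite [c]all0 [RHS]all0.
rewrite -[b]quot_reprK; set z := quot_repr b.
apply/quot_classP; rewrite unfold_in; apply/asboolP.
pose x := val (val z : kernel (hr_p r) k) : A k.
have px : p k k x = 0 by have := ker_valP (val z); rewrite unfold_in => /eqP.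
have dx : d k (k - 1) x = 0.
  by have := ker_valP z; rewrite unfold_in => /eqP /(congr1 val).
exists (to_kernel (k + 1) (k + 1) (- h k (k + 1) x)).
apply: val_inj; rewrite subr0.
transitivity
  (d (k + 1) k (complement_proj (k + 1) (k + 1) (- h k (k + 1) x))) => //.
rewrite complement_projE linearB/= retract_i_cycle subr0 linearN.
rewrite -[LHS]addr0 -[X in _ + X]oppr0 -[X in _ - X](linear0 (h (k - 1) k)) -dx.
by rewrite -opprD retract_homotopy px linear0 sub0r opprK.
Qed.

(** The term of order 0 is (p, q) with q = 1 - i p, inverse to
    (u, v) |-> i u + v. *)
Lemma splitting_iso :
  infty_isomorphism (pairing homology_morphism kernel_morphism).
Proof.
have homE k (x : A k) : homology_op 0 k k x = p k k x.
  by rewrite /= /resolvent_fun big_ord0 linear0 addr0.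
have kerE k (x : A k) : val (kernel_op 0 k k x) = x - i k k (p k k x).
  by rewrite -complement_projE /= !linear0 addr0 oppr0 subr0.
move=> k; exists (fun u => i k k u.1 + val u.2) => [x|[u v]].
  rewrite -[RHS](subrKC (i k k (p k k x)) x).
  by congr (i k k _ + _); [apply: homE|apply: kerE].
have pE : p k k (i k k u + val v) = u.
  rewrite linearD/= retract_pi; have := ker_valP v; rewrite unfold_in => /eqP->.
  exact: addr0.
apply: injective_projections; first by apply: etrans (homE _ _) _.
by apply: val_inj; apply: etrans (kerE _ _) _; rewrite pE addrC addKr.
Qed.

End Splitting.

Theorem theorem1p6 (F : fieldType) (charF0 : [pchar F] =i pred0)
    (A : multicomplex F) :
  inhabited (homotopy_retract (mc_complex A)
                              (homology_complex (mc_complex A))) /\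
  forall r : homotopy_retract (mc_complex A)
                              (homology_complex (mc_complex A)),
  exists axH : multicomplex_axiom (transferred r),
    let H := Multicomplex axH in
    minimal H /\
    exists K : multicomplex F,
      [/\ acyclic K, trivial K &
          exists f : infty_morphism A (product H K), infty_isomorphism f].
Proof.
split; first exact: homology_retract_exists.
move=> r; exists (@transferred_axiom _ _ r) => H.
split; first exact: homology_part_minimal.
exists (kernel_part r); split.
- exact: kernel_part_acyclic.
- exact: trivial_multicomplexP.
- exists (pairing (homology_morphism r) (kernel_morphism r)).
  exact: splitting_iso.
Qed.
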